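(* Let $u$ (with pressure $p$) be a suitable weak solution of the incompressible Navier–Stokes equations with force $f\in L^2(\Omega\times[0,T])$, assume $$T\ge \frac{R_0^2}{\nu},$$ and set $\alpha_0=\sqrt{8}\,K_2$, $\beta_0=8C_0K_2$. Let $e_0,\varepsilon_0,F_0$ be the global energy, the global dissipation rate and the root-mean-square force on the integral domain $\Omega_0=B(0,R_0)$, and let $\tau_0=(\nu e_0/\varepsilon_0)^{1/2}$ (with $\varepsilon_0>0$). Assume $$\alpha_0 F_0\,e_0^{1/2}\le\varepsilon_0\qquad\text{and}\qquad \beta_0\,\nu\,\frac{e_0}{R_0^2}\le\varepsilon_0 .$$ Then for every $R\in\left[\sqrt{\beta_0}\,\tau_0,\;R_0\right]$ and every $(K_1,K_2)$-covering of $\Omega_0$ at scale $R$ with associated refined cut-offs, the averaged energy flux satisfies $$\frac{1}{4K_1}\,\varepsilon_0\le \langle \Phi\rangle_R\le \frac{9K_2}{4}\,\varepsilon_0 .$$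
   Context: Setting. $\Omega\subseteq\mathbb{R}^3$ is a domain, $\nu>0$, $T>0$, $R_0>0$ with $B(0,2R_0)\subseteq\Omega$, and $\Omega_0=B(0,R_0)$. The 3D incompressible Navier–Stokes equations (NSE) are $\partial_t u-\nu\Delta u+(u\cdot\nabla)u+\nabla p=f$, $\nabla\cdot u=0$. A suitable weak solution $(u,p)$ is a distributional solution, in the usual Scheffer / Caffarelli–Kohn–Nirenberg sense ($u\in L^\infty_tL^2_x\cap L^2_tH^1_x$, $p\in L^{3/2}$ locally), satisfying the local energy inequality $$\iint\Big(\frac{|u|^2}{2}+p\Big)u\cdot\nabla\phi\ \ge\ \nu\iint|\nabla u|^2\phi-\iint\frac{|u|^2}{2}(\partial_t\phi+\nu\Delta\phi)-\iint f\cdot u\,\phi$$ for every smooth compactly supported test function $\phi\ge0$ (including the test functions $\eta\psi$ used below). Constants. $C_0>0$, $\delta\in(1/2,1)$ and $K_1,K_2>0$ are fixed. Refined cut-offs. A refined space cut-off for a ball $B(x_0,R)$ is a smooth $\psi$ with $0\le\psi\le1$, $\mathrm{Supp}(\psi)\subseteq B(x_0,2R)$, $\psi=1$ on $B(x_0,R)$, $|\nabla\psi|\le \frac{C_0}{R}\psi^{\delta}$ and $|\Delta\psi|\le\frac{C_0}{R^2}\psi^{2\delta-1}$. A refined time cut-off on $[0,T]$ is a smooth $\eta$ with $0\le\eta\le1$, $\mathrm{Supp}(\eta)\subseteq[0,T]$ and $|\eta'|\le\frac{C_0}{T}\eta^\delta$. Fix such an $\eta$, fix a refined space cut-off $\psi_0$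 for $\Omega_0=B(0,R_0)$ (global cut-off), and put $\phi_0=\eta\psi_0$. Coverings. For $0<R\le R_0$, a $(K_1,K_2)$-covering at scale $R$ is a covering of $\Omega_0$ by $n$ balls $B(x_i,R)$, $x_i\in\Omega_0$, with $(R_0/R)^3\le n\le K_1(R_0/R)^3$ and such that each point of $\Omega_0$ belongs to at most $K_2$ of the balls $B(x_i,2R)$. To each ball is associated a refined cut-off $\psi_i$; for balls near the boundary of $\Omega_0$ the support and plateau requirements are modified so that $$\psi_0(x)\le\sum_{i=1}^n\psi_i(x)\le K_2\psi_0(x)\quad\text{for all }x\in\mathbb{R}^3,$$ with at most $K_2$ of the $\psi_i$ nonzero at each point, while $0\le\psi_i\le1$, $|\nabla\psi_i|\le\frac{C_0}{R}\psi_i^\delta$ and $|\Delta\psi_i|\le\frac{C_0}{R^2}\psi_i^{2\delta-1}$ still hold. Put $\phi_i=\eta\psi_i$. Flux. $\Phi_i=\frac1T\frac1{R^3}\iint\big(\frac{|u|^2}{2}+p\big)u\cdot\nabla\phi_i$ and $\langle\Phi\rangle_R=\frac1n\sum_{i=1}^n\Phi_i$. Global quantities. $$e_0=\frac1T\frac1{R_0^3}\iint\frac{|u|^2}{2}\phi_0^{2\delta-1},\qquad F_0=\Big(\frac1T\frac1{R_0^3}\iint|f|^2\phi_0\Big)^{1/2},\qquad \varepsilon_0=\frac1T\frac1{R_0^3}\Big(\nu\iint|\nabla u|^2\phi_0+(\epsilon^\infty,\phi_0)\Big),$$ where the anomalous dissipation $\epsilon^\infty$ is the non-negative distribution given by the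 defect in the local energy inequality, i.e. $(\epsilon^\infty,\phi)=\iint\big(\frac{|u|^2}{2}+p\big)u\cdot\nabla\phi-\nu\iint|\nabla u|^2\phi+\iint\frac{|u|^2}{2}(\partial_t\phi+\nu\Delta\phi)+\iint f\cdot u\,\phi$. *)

(* Defs.v *)
From HB Require Import structures.
From mathcomp Require Import all_boot all_order all_algebra.
From mathcomp Require Import all_classical all_reals all_analysis.
Set Implicit Arguments.
Unset Strict Implicit.
Unset Printing Implicit Defensive.
Import Order.TTheory GRing.Theory Num.Theory.
Import numFieldNormedType.Exports.
Local Open Scope classical_set_scope.
Local Open Scope ring_scope.

(* Space is the product R * R * R, a carrier on which the library has both a
   topology and (product) Lebesgue measure.  The library norm on a product is
   the sup norm; Euclidean norms and balls are therefore defined below. *)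
Notation space3 R := (R * R * R)%type.
Notation spacetime3 R := (R * R * R * R)%type.

Notation leb3 R :=
  ((@lebesgue_measure R%type \x @lebesgue_measure R%type)
    \x @lebesgue_measure R%type)%E.
Notation leb4 R :=
  ((@lebesgue_measure R%type \x @lebesgue_measure R%type)
    \x @lebesgue_measure R%type \x @lebesgue_measure R%type)%E.

Definition xcoord (R : realType) (x : space3 R) (i : 'I_3) : R :=
  tnth [tuple x.1.1; x.1.2; x.2] i.

Definition evec (R : realType) (i : 'I_3) : space3 R :=
  ((val i == 0)%N%:R, (val i == 1)%N%:R, (val i == 2)%N%:R).

Definition enorm (R : realType) (v : 'I_3 -> R) : R :=
  Num.sqrt (\sum_i v i ^+ 2).

Definition eball (R : realType) (x : space3 R) (r : R) : set (space3 R) :=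
  [set y | enorm (xcoord (y - x)) < r].

Fixpoint Ck (R : realType) (V : normedModType R) (k : nat) (f : V -> R)
    : Prop :=
  continuous f /\
  match k with
  | 0 => True
  | k'.+1 => forall v : V,
      (forall x, derivable f x v) /\ Ck k' (fun x => 'D_v f x)
  end.

Definition smooth (R : realType) (V : normedModType R) (f : V -> R) : Prop :=
  forall k, Ck k f.

Definition supp (R : realType) (V : normedModType R) (f : V -> R) : set V :=
  closure [set x | f x != 0].

Definition grad (R : realType) (psi : space3 R -> R) (x : space3 R) (i : 'I_3)
    : R :=
  'D_(evec R i) psi x.

Definition lap (R : realType) (psi : space3 R -> R) (x : space3 R) : R :=
  \sum_(i < 3) 'D_(evec R i) (fun y => 'D_(evec R i) psi y) x.

Definition dt (R : realType) (phi : spacetime3 R -> R) (z : spacetime3 R) : R :=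
  'D_((0, 1) : spacetime3 R) phi z.

Definition dx (R : realType) (i : 'I_3) (phi : spacetime3 R -> R)
    (z : spacetime3 R) : R :=
  'D_((evec R i, 0) : spacetime3 R) phi z.

Definition lapx (R : realType) (phi : spacetime3 R -> R) (z : spacetime3 R) : R :=
  \sum_(i < 3) dx i (dx i phi) z.

(* Test functions supported in Omega x I, where I is ]0, T[ for the
   distributional formulations and [0, T] for the local energy inequality. *)
Definition test_fun (R : realType) (Omega : set (space3 R)) (I : set R)
    (phi : spacetime3 R -> R) : Prop :=
  [/\ smooth phi, compact (supp phi) & supp phi `<=` Omega `*` I].

Definition sqnorm (R : realType) (u : 'I_3 -> spacetime3 R -> R)
    (z : spacetime3 R) : R :=
  \sum_(i < 3) u i z ^+ 2.

Definition sqnorm2 (R : realType) (Du : 'I_3 -> 'I_3 -> spacetime3 R -> R)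
    (z : spacetime3 R) : R :=
  \sum_(i < 3) \sum_(j < 3) Du i j z ^+ 2.

Definition cylinder (R : realType) (Omega : set (space3 R)) (T : R)
    : set (spacetime3 R) :=
  Omega `*` `[0, T].

Definition square_integrable_field (R : realType) (D : set (spacetime3 R))
    (f : 'I_3 -> spacetime3 R -> R) : Prop :=
  (forall i, measurable_fun D (f i)) /\
  (\int[leb4 R]_(z in D) (sqnorm f z)%:E < +oo)%E.

(* Du i j is the distributional derivative of u_i in the direction x_j. *)
Definition weak_gradient (R : realType) (Omega : set (space3 R)) (T : R)
    (u : 'I_3 -> spacetime3 R -> R) (Du : 'I_3 -> 'I_3 -> spacetime3 R -> R)
    : Prop :=
  forall i j phi, test_fun Omega `]0, T[ phi ->
    \int[leb4 R]_(z in cylinder Omega T) (u i z * dx j phi z) =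
    - \int[leb4 R]_(z in cylinder Omega T) (Du i j z * phi z).

Definition div_free (R : realType) (Omega : set (space3 R)) (T : R)
    (u : 'I_3 -> spacetime3 R -> R) : Prop :=
  forall phi, test_fun Omega `]0, T[ phi ->
    \int[leb4 R]_(z in cylinder Omega T) (\sum_(i < 3) u i z * dx i phi z) = 0.

Definition momentum_equation (R : realType) (nu : R) (Omega : set (space3 R))
    (T : R) (f u : 'I_3 -> spacetime3 R -> R) (p : spacetime3 R -> R) : Prop :=
  forall i phi, test_fun Omega `]0, T[ phi ->
    \int[leb4 R]_(z in cylinder Omega T)
      (u i z * (dt phi z + nu * lapx phi z)
       + \sum_(j < 3) u i z * u j z * dx j phi z
       + p z * dx i phi z + f i z * phi z) = 0.

(* (|u|^2/2 + p) u . grad phi *)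
Definition flux_density (R : realType) (u : 'I_3 -> spacetime3 R -> R)
    (p phi : spacetime3 R -> R) (z : spacetime3 R) : R :=
  (sqnorm u z / 2 + p z) * \sum_(i < 3) u i z * dx i phi z.

Definition flux_integral (R : realType) (Omega : set (space3 R)) (T : R)
    (u : 'I_3 -> spacetime3 R -> R) (p phi : spacetime3 R -> R) : R :=
  \int[leb4 R]_(z in cylinder Omega T) flux_density u p phi z.

Definition viscous_integral (R : realType) (Omega : set (space3 R)) (T : R)
    (Du : 'I_3 -> 'I_3 -> spacetime3 R -> R) (phi : spacetime3 R -> R) : R :=
  \int[leb4 R]_(z in cylinder Omega T) (sqnorm2 Du z * phi z).

Definition heat_integral (R : realType) (nu : R) (Omega : set (space3 R)) (T : R)
    (u : 'I_3 -> spacetime3 R -> R) (phi : spacetime3 R -> R) : R :=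
  \int[leb4 R]_(z in cylinder Omega T)
    (sqnorm u z / 2 * (dt phi z + nu * lapx phi z)).

Definition force_integral (R : realType) (Omega : set (space3 R)) (T : R)
    (f u : 'I_3 -> spacetime3 R -> R) (phi : spacetime3 R -> R) : R :=
  \int[leb4 R]_(z in cylinder Omega T) ((\sum_(i < 3) f i z * u i z) * phi z).

(* Since [Rintegral] returns a junk value on non-integrable functions, the
   convergence of the cubic flux integral is recorded as part of the meaning of
   the inequality; in the energy class below it is automatic (Sobolev gives
   u in L^{10/3}_loc).  The other three integrals converge by the L^2 bounds. *)
Definition local_energy_inequality (R : realType) (nu : R)
    (Omega : set (space3 R)) (T : R) (f u : 'I_3 -> spacetime3 R -> R)
    (p : spacetime3 R -> R) (Du : 'I_3 -> 'I_3 -> spacetime3 R -> R) : Prop :=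
  forall phi, test_fun Omega `[0, T] phi -> (forall z, 0 <= phi z) ->
    (leb4 R).-integrable (cylinder Omega T)
      (fun z => (flux_density u p phi z)%:E) /\
    nu * viscous_integral Omega T Du phi - heat_integral nu Omega T u phi
      - force_integral Omega T f u phi
    <= flux_integral Omega T u p phi.

(* "Locally" means on K x [0, T] with K a compact subset of Omega. *)
Record suitable_weak_solution (R : realType) (nu : R) (Omega : set (space3 R))
    (T : R) (f u : 'I_3 -> spacetime3 R -> R) (p : spacetime3 R -> R)
    (Du : 'I_3 -> 'I_3 -> spacetime3 R -> R) : Prop := {
  sws_meas_u : forall i, measurable_fun (cylinder Omega T) (u i);
  sws_meas_Du : forall i j, measurable_fun (cylinder Omega T) (Du i j);
  sws_meas_p : measurable_fun (cylinder Omega T) p;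
  sws_LinftyL2 : forall K, compact K -> K `<=` Omega ->
    exists M : R, {ae @lebesgue_measure R, forall t, `[0, T]%classic t ->
      (\int[leb3 R]_(x in K) (sqnorm u (x, t))%:E <= M%:E)%E};
  sws_weak_gradient : weak_gradient Omega T u Du;
  sws_L2H1 : forall K, compact K -> K `<=` Omega ->
    (\int[leb4 R]_(z in cylinder K T) (sqnorm2 Du z)%:E < +oo)%E;
  sws_p : forall K, compact K -> K `<=` Omega ->
    (\int[leb4 R]_(z in cylinder K T) (`|p z| `^ (3 / 2))%:E < +oo)%E;
  sws_div_free : div_free Omega T u;
  sws_momentum : momentum_equation nu Omega T f u p;
  sws_energy : local_energy_inequality nu Omega T f u p Du
}.

Definition cutoff_bounds (R : realType) (C0 delta r : R) (psi : space3 R -> R)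
    : Prop :=
  [/\ smooth psi,
      forall x, 0 <= psi x <= 1,
      forall x, enorm (grad psi x) <= C0 / r * psi x `^ delta &
      forall x, `|lap psi x| <= C0 / r ^+ 2 * psi x `^ (2 * delta - 1)].

Definition refined_space_cutoff (R : realType) (C0 delta : R) (x0 : space3 R)
    (r : R) (psi : space3 R -> R) : Prop :=
  [/\ cutoff_bounds C0 delta r psi,
      supp psi `<=` eball x0 (2 * r) &
      forall x, eball x0 r x -> psi x = 1].

Definition refined_time_cutoff (R : realType) (C0 delta T : R) (eta : R -> R)
    : Prop :=
  [/\ smooth eta,
      forall t, 0 <= eta t <= 1,
      supp eta `<=` `[0, T] &
      forall t, `|derive1 eta t| <= C0 / T * eta t `^ delta].

Definition st_cutoff (R : realType) (eta : R -> R) (psi : space3 R -> R)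
    (z : spacetime3 R) : R :=
  eta z.2 * psi z.1.

(* Balls with B(c_i, 2r) inside B(0, R0) carry unmodified refined cut-offs;
   for the remaining ones, near the boundary, the support and plateau
   requirements are replaced by the comparison with psi0. *)
Record refined_covering (R : realType) (C0 delta K1 K2 R0 : R)
    (psi0 : space3 R -> R) (r : R) (n : nat) (c : 'I_n -> space3 R)
    (psi : 'I_n -> space3 R -> R) : Prop := {
  rc_scale : 0 < r <= R0;
  rc_center : forall i, eball 0 R0 (c i);
  rc_cover : eball 0 R0 `<=` \bigcup_i eball (c i) r;
  rc_card : (R0 / r) ^+ 3 <= n%:R <= K1 * (R0 / r) ^+ 3;
  rc_multiplicity : forall x, eball 0 R0 x ->
    #|[pred i | enorm (xcoord (x - c i)) < 2 * r]|%:R <= K2;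
  rc_bounds : forall i, cutoff_bounds C0 delta r (psi i);
  rc_interior : forall i, eball (c i) (2 * r) `<=` eball 0 R0 ->
    refined_space_cutoff C0 delta (c i) r (psi i);
  rc_sum : forall x, psi0 x <= \sum_i psi i x <= K2 * psi0 x;
  rc_overlap : forall x, #|[pred i | psi i x != 0]|%:R <= K2
}.

Definition local_flux (R : realType) (Omega : set (space3 R)) (T r : R)
    (u : 'I_3 -> spacetime3 R -> R) (p phi : spacetime3 R -> R) : R :=
  1 / T * (1 / r ^+ 3) * flux_integral Omega T u p phi.

Definition averaged_flux (R : realType) (Omega : set (space3 R)) (T r : R)
    (u : 'I_3 -> spacetime3 R -> R) (p : spacetime3 R -> R) (eta : R -> R)
    (n : nat) (psi : 'I_n -> space3 R -> R) : R :=
  1 / n%:R * \sum_(i < n) local_flux Omega T r u p (st_cutoff eta (psi i)).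

Definition anomalous_dissipation (R : realType) (nu : R)
    (Omega : set (space3 R)) (T : R) (f u : 'I_3 -> spacetime3 R -> R)
    (p : spacetime3 R -> R) (Du : 'I_3 -> 'I_3 -> spacetime3 R -> R)
    (phi : spacetime3 R -> R) : R :=
  flux_integral Omega T u p phi - nu * viscous_integral Omega T Du phi
  + heat_integral nu Omega T u phi + force_integral Omega T f u phi.

Definition global_energy (R : realType) (delta : R) (Omega : set (space3 R))
    (T R0 : R) (u : 'I_3 -> spacetime3 R -> R) (phi0 : spacetime3 R -> R) : R :=
  1 / T * (1 / R0 ^+ 3) * \int[leb4 R]_(z in cylinder Omega T)
    (sqnorm u z / 2 * phi0 z `^ (2 * delta - 1)).

Definition global_force (R : realType) (Omega : set (space3 R)) (T R0 : R)
    (f : 'I_3 -> spacetime3 R -> R) (phi0 : spacetime3 R -> R) : R :=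
  Num.sqrt (1 / T * (1 / R0 ^+ 3) *
    \int[leb4 R]_(z in cylinder Omega T) (sqnorm f z * phi0 z)).

Definition global_dissipation (R : realType) (nu : R) (Omega : set (space3 R))
    (T R0 : R) (f u : 'I_3 -> spacetime3 R -> R) (p : spacetime3 R -> R)
    (Du : 'I_3 -> 'I_3 -> spacetime3 R -> R) (phi0 : spacetime3 R -> R) : R :=
  1 / T * (1 / R0 ^+ 3) *
    (nu * viscous_integral Omega T Du phi0
     + anomalous_dissipation nu Omega T f u p Du phi0).

(* Main.v *)
Require Import Defs.
From HB Require Import structures.
From mathcomp Require Import all_boot all_order all_algebra.
From mathcomp Require Import all_classical all_reals all_analysis.
From mathcomp Require Import ring lra.
From mathcomp Require Import measurable_realfun.
Set Implicit Arguments.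
Unset Strict Implicit.
Unset Printing Implicit Defensive.
Import Order.TTheory GRing.Theory Num.Theory.
Import numFieldNormedType.Exports.
Local Open Scope classical_set_scope.
Local Open Scope ring_scope.

(** Put L(phi) for the sum of the flux, heat and force integrals of the local
    energy inequality tested with phi.  Then L is linear, L(phi) dominates the
    viscous integral and hence is non-negative for phi >= 0, and
    T R0^3 eps0 = L(phi0), because the viscous terms cancel.  Writing
    phi = sum_i phi_i, the test functions phi - phi0 and K2 phi0 - phi are
    non-negative, so L(phi0) <= L(phi) <= K2 L(phi0).  The flux of phi differs
    from L(phi) by the heat term, at most eps0/4 (in units of T R0^3) by the
    refined cut-off bounds and the choice of the scale, and by the force term,
    at most eps0/2 by Cauchy-Schwarz. *)

(** Comparing test functions keeps the anomalous dissipation global: only the sign of the defect is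
    used, and no single local flux is estimated. The obstacle is the exponent. The refined bounds
    control the heat operator on phi_i by phi_i^(2 delta - 1), and sums of such powers are not
    controlled by the sum of the phi_i alone; bounded overlap together with concavity of the power
    restores the constant K2. In units of T R0^3, the heat terms cost 2 C0 K2 nu e0 / R^2, which is
    at most eps0/4 exactly when R^2 >= beta0 tau0^2, and the force terms cost sqrt 2 K2 F0 e0^(1/2),
    which is half of alpha0 F0 e0^(1/2). Linearity of L requires each density to be integrable. The
    cubic one is integrable by the local energy inequality; the heat and force densities are
    dominated by multiples of |f|^2 and of |u|^2 on a compact cylinder, the latter being integrable
    by Tonelli and the L^infinity L^2 bound. *)

(** * Borel measurability on the product space *)

(* Network in the topological sense: its members need not be open. *)
Definition countable_network {X : topologicalType} (M : set_system X) : Prop :=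
  exists (I : countType) (B : I -> set X), (forall i, M (B i)) /\
    forall x U, nbhs x U -> exists i, B i x /\ B i `<=` U.

Lemma countable_network_real (R : realType) :
  @countable_network R (@measurable _ (measurableTypeR R)).
Proof.
exists (rat * rat)%type, (fun q => `]ratr q.1, ratr q.2[%classic); split.
  by move=> q; exact: measurable_itv.
move=> x U /nbhs_ballP[e /= e0 xU].
have /rat_in_itvoo[q1 /itvP q1P] : x - e < x by rewrite ltrBlDr ltrDl.
have /rat_in_itvoo[q2 /itvP q2P] : x < x + e by rewrite ltrDl.
exists (q1, q2); split; first by rewrite /= in_itv/= q1P q2P.
move=> y /=; rewrite in_itv/= => /andP[q1y yq2]; apply: xU.
rewrite -ball_normE /ball_ /=.
have q1e : x - e < ratr q1 by rewrite q1P.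
have q2e : ratr q2 < x + e by rewrite q2P.
by rewrite ltr_norml; apply/andP; split; lra.
Qed.

Lemma countable_network_prod {X Y : topologicalType} (MX : set_system X)
    (MY : set_system Y) (M : set_system (X * Y)) :
  (forall A B, MX A -> MY B -> M (A `*` B)) ->
  countable_network MX -> countable_network MY -> countable_network M.
Proof.
move=> MXY [I [B [mB nB]]] [J [D [mD nD]]].
exists (I * J)%type, (fun ij => B ij.1 `*` D ij.2); split.
  by move=> ij; exact: MXY.
move=> [x y] U [[V W] /= [Vx Wy] VWU].
have [i [Bix BiV]] := nB _ _ Vx; have [j [Djy DjW]] := nD _ _ Wy.
exists (i, j); split => // -[x' y'] [/= /BiV ? /DjW ?]; exact: VWU.
Qed.

Lemma countable_network_space3 (R : realType) :
  @countable_network (space3 R) (fun A : set (space3 R) => measurable A).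
Proof.
do 2![apply: countable_network_prod (countable_network_real R);
      first by move=> A B; exact: measurableX].
exact: countable_network_real.
Qed.

(** [U] is the union of the network members it contains; replacing the others by the empty set keeps
    the index type countable. With rational boxes this places the open sets of space in the product
    sigma-algebra. *)
Lemma network_open {X : topologicalType} (M : set_system X) :
  M set0 -> (forall (I : countType) (F : I -> set X), (forall i, M (F i)) ->
    M (\bigcup_i F i)) ->
  countable_network M -> forall U, open U -> M U.
Proof.
move=> M0 Mbig [I [B [mB nB]]] U oU.
rewrite (_ : U = \bigcup_i if `[< B i `<=` U >] then B i else set0).
  by apply: Mbig => i; case: ifP.
apply/seteqP; split => [x Ux|x [i _]]; last by case: asboolP => // BU /BU.
have [i [Bix BiU]] := nB _ _ (open_nbhs_nbhs (conj oU Ux)).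
by exists i => //; case: asboolP.
Qed.

Lemma open_measurable_space3 (R : realType) (U : set (space3 R)) :
  open U -> measurable U.
Proof.
apply: network_open (countable_network_space3 R) _ => //.
by move=> I F mF; exact: countable_bigcupT_measurable.
Qed.

Lemma continuous_measurable_space3 (R : realType) (g : space3 R -> R) :
  continuous g -> measurable_fun setT (g : space3 R -> measurableTypeR R).
Proof.
move=> /continuousP cg.
apply: (measurability _ (RGenOpens.measurableE R)).
move=> _ [_ [a [b ->] <-]]; rewrite setTI; apply: open_measurable_space3.
exact/cg/interval_open.
Qed.

(** * Closure properties of smooth functions *)

Section Ck.
Context {R : realType} {V : normedModType R}.
Implicit Types f g : V -> R.

Lemma CkS k f : Ck k.+1 f -> Ck k f.
Proof.
elim: k f => [|k IH] f [cf df]; first by split.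
by split => // v; have [dfv /IH] := df v.
Qed.

Lemma Ck_continuous k f : Ck k f -> continuous f.
Proof. by case: k => [|k] []. Qed.

Lemma CkD k f g : Ck k f -> Ck k g -> Ck k (fun x => f x + g x).
Proof.
elim: k f g => [|k IH] f g [cf df] [cg dg].
  by split => // x; apply: continuousD; [exact: cf|exact: cg].
split=> [x|v]; first by apply: continuousD; [exact: cf|exact: cg].
have [dfv fk] := df v; have [dgv gk] := dg v; split.
  by move=> x; exact: derivableD.
rewrite (_ : 'D_v _ = (fun x => 'D_v f x + 'D_v g x)); first exact: IH.
by apply/funext => x; rewrite -deriveD.
Qed.

Lemma CkM k f g : Ck k f -> Ck k g -> Ck k (fun x => f x * g x).
Proof.
elim: k f g => [|k IH] f g Cf Cg.
  by case: Cf Cg => cf _ [cg _]; split => // x;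
    apply: continuousM; [exact: cf|exact: cg].
(* The product rule pairs each derivative with an undifferentiated factor, so the induction also
   needs both factors at order [k]. *)
have fk := CkS Cf; have gk := CkS Cg; case: Cf Cg => [cf df] [cg dg].
split=> [x|v]; first by apply: continuousM; [exact: cf|exact: cg].
have [dfv fk'] := df v; have [dgv gk'] := dg v; split.
  by move=> x; exact: derivableM.
rewrite (_ : 'D_v _ = (fun x => f x * 'D_v g x + g x * 'D_v f x)).
  by apply: CkD; apply: IH.
by apply/funext => x; exact: (deriveM (dfv x) (dgv x)).
Qed.

Lemma Ck_cst k (a : R) : Ck k (fun _ : V => a).
Proof.
elim: k a => [|k IH] a; first by split => // x; exact: cvg_cst.
split=> [x|v]; first exact: cvg_cst.
split=> [x|]; first exact: derivable_cst.
rewrite (_ : 'D_v _ = (fun=> 0)) //.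
by apply/funext => x; exact: derive_cst.
Qed.

Lemma smoothD f g : smooth f -> smooth g -> smooth (fun x => f x + g x).
Proof. by move=> Cf Cg k; exact: CkD. Qed.

Lemma smoothM f g : smooth f -> smooth g -> smooth (fun x => f x * g x).
Proof. by move=> Cf Cg k; exact: CkM. Qed.

Lemma smooth_cst (a : R) : smooth (fun _ : V => a).
Proof. by move=> k; exact: Ck_cst. Qed.

Lemma smooth_sum n (f : 'I_n -> V -> R) :
  (forall i, smooth (f i)) -> smooth (fun x => \sum_i f i x).
Proof.
move=> Cf; elim: n f Cf => [|n IH] f Cf.
  by under eq_fun do rewrite big_ord0; exact: smooth_cst.
under eq_fun do rewrite big_ord_recl.
by apply: smoothD => //; exact: IH.
Qed.

Lemma smooth_continuous f : smooth f -> continuous f.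
Proof. by move=> /(_ 0%N)/Ck_continuous. Qed.

Lemma smooth_derivable f x v : smooth f -> derivable f x v.
Proof. by move=> /(_ 1%N)[_ /(_ v)[]]. Qed.

Lemma smooth_derive f v : smooth f -> smooth ('D_v f).
Proof. by move=> Cf k; have [_ /(_ v)[]] := Cf k.+1. Qed.

End Ck.

Section smooth_prod.
Context {R : realType} {U V : normedModType R}.

Lemma smooth_fst (g : U -> R) : smooth g -> smooth (fun z : U * V => g z.1).
Proof.
move=> Cg k; elim: k g Cg => [|k IH] g Cg.
  by split => // z; apply: continuous_comp; [exact: cvg_fst|
    exact: (smooth_continuous Cg)].
split=> [z|v].
  by apply: continuous_comp; [exact: cvg_fst|exact: (smooth_continuous Cg)].
split=> [z|]; first exact: (smooth_derivable Cg).
(* The difference quotients of [g \o fst] along [v] are those of [g] along [v.1], so the derivative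
   again factors through [fst]. *)
by apply: (IH ('D_(v.1) g)); exact: smooth_derive.
Qed.

Lemma smooth_snd (g : V -> R) : smooth g -> smooth (fun z : U * V => g z.2).
Proof.
move=> Cg k; elim: k g Cg => [|k IH] g Cg.
  by split => // z; apply: continuous_comp; [exact: cvg_snd|
    exact: (smooth_continuous Cg)].
split=> [z|v].
  by apply: continuous_comp; [exact: cvg_snd|exact: (smooth_continuous Cg)].
split=> [z|]; first exact: (smooth_derivable Cg).
by apply: (IH ('D_(v.2) g)); exact: smooth_derive.
Qed.

End smooth_prod.

(** * Derivatives of the space-time cut-offs *)

Section st_cutoff.
Context {R : realType} (eta : R -> R) (psi : space3 R -> R).
Hypothesis (Ceta : smooth eta) (Cpsi : smooth psi).

Lemma smooth_st_cutoff : smooth (st_cutoff eta psi).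
Proof. by apply: smoothM; [exact: smooth_snd|exact: smooth_fst]. Qed.

Lemma derive_st_cutoff (v z : spacetime3 R) :
  'D_v (st_cutoff eta psi) z =
  eta z.2 * 'D_(v.1) psi z.1 + psi z.1 * 'D_(v.2) eta z.2.
Proof.
have de : derivable (eta \o snd) z v.
  exact: (smooth_derivable Ceta).
have dp : derivable (psi \o fst) z v.
  exact: (smooth_derivable Cpsi).
exact: (deriveM de dp).
Qed.

Lemma dx_st_cutoff i z :
  dx i (st_cutoff eta psi) z = eta z.2 * grad psi z.1 i.
Proof. by rewrite /dx derive_st_cutoff/= derive0 mulr0 addr0. Qed.

Lemma dt_st_cutoff z :
  dt (st_cutoff eta psi) z = derive1 eta z.2 * psi z.1.
Proof.
by rewrite /dt derive_st_cutoff/= derive0 mulr0 add0r derive1E mulrC.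
Qed.

End st_cutoff.

Lemma lapx_st_cutoff (R : realType) (eta : R -> R) (psi : space3 R -> R) z :
  smooth eta -> smooth psi ->
  lapx (st_cutoff eta psi) z = eta z.2 * lap psi z.1.
Proof.
move=> Ceta Cpsi; rewrite /lapx /lap mulr_sumr; apply: eq_bigr => i _.
(* A spatial derivative of a cut-off is again a product of this shape, so the first-order formula
   applies twice. *)
rewrite (_ : dx i (st_cutoff eta psi) = st_cutoff eta ('D_(evec R i) psi)).
  by rewrite dx_st_cutoff//; exact: smooth_derive.
by apply/funext => y; rewrite dx_st_cutoff.
Qed.

(** * Elementary inequalities: concavity and quadratic optimisation *)

Lemma powR_le_tangent (R : realType) (s x : R) : 0 < s < 1 -> 0 <= x ->
  x `^ s <= s * x + (1 - s).
Proof.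
move=> /andP[s0 s1] x0.
have := @conjugate_powR R (x `^ s) 1 s^-1 (1 - s)^-1.
rewrite powR1 powR_ge0 ler01 !invr_gt0 s0 subr_gt0 s1 !invrK mulr1 mul1r.
rewrite -powRrM divff ?gt_eqF// powRr1// mulrC => -> //.
by rewrite addrC subrK.
Qed.

(* Jensen for the concave power, in the form of the tangent line at b. *)
Lemma sum_powR_le (R : realType) n (s K b : R) (a : 'I_n -> R) :
  0 < s < 1 -> 0 <= b -> (forall i, 0 <= a i) -> \sum_i a i <= K * b ->
  #|[pred i | a i != 0]|%:R <= K ->
  \sum_i a i `^ s <= K * b `^ s.
Proof.
move=> /[dup] s01 /andP[s0 s1] b0 a0 aKb aK.
have [b00|bn0] := eqVneq b 0.
  have az i : a i = 0.
    apply/eqP; rewrite eq_le a0 andbT; move: aKb; rewrite b00 mulr0.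
    by apply: le_trans; rewrite (bigD1 i)//= lerDl sumr_ge0.
  rewrite b00 powR0 ?gt_eqF// mulr0 big1// => i _.
  by rewrite az powR0// gt_eqF.
have bgt0 : 0 < b by rewrite lt_neqAle eq_sym bn0.
(* The indicator drops the constant part of the tangent line at zero entries. It is thus summed over
   at most [K] indices, and the total is s K + (1 - s) K = K. *)
have tangent i : a i `^ s <= b `^ s * (s * (a i / b) + (1 - s) * (a i != 0)%:R).
  have [->|_] := eqVneq (a i) 0.
    by rewrite powR0 ?gt_eqF// mul0r !mulr0 addr0 mulr0.
  rewrite mulr1 -{1}(divfK bn0 (a i)) powRM ?divr_ge0// mulrC.
  by rewrite ler_wpM2l ?powR_ge0// powR_le_tangent// divr_ge0.
apply: le_trans (ler_sum _ (fun i _ => tangent i)) _.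
rewrite -mulr_sumr mulrC ler_wpM2r ?powR_ge0// big_split/= -!mulr_sumr.
have cardE : \sum_i (a i != 0)%:R = #|[pred i | a i != 0]|%:R :> R.
  by rewrite -natr_sum -sum1_card [in RHS]big_mkcond.
have sumb : \sum_i a i / b <= K by rewrite -mulr_suml ler_pdivrMr.
rewrite cardE (_ : K = s * K + (1 - s) * K); last by ring.
by rewrite lerD// ler_wpM2l// ?subr_ge0 ltW.
Qed.

(** A discriminant argument: it turns a family of weighted Young inequalities into
    Cauchy-Schwarz. *)
Lemma le_mul_of_quadratic (R : realType) (Y a b : R) : 0 <= a -> 0 <= b ->
  (forall l, 0 < l -> 2 * l * Y <= l ^+ 2 * a ^+ 2 + b ^+ 2) -> Y <= a * b.
Proof.
move=> a0 b0 H; have [Y0|Y0] := leP Y 0; first exact: le_trans (mulr_ge0 _ _).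
have [az|an0] := eqVneq a 0.
  (* With [a = 0], this weight would give 2 (b^2 + 1) <= b^2. *)
  have l0 : 0 < (b ^+ 2 + 1) / Y by rewrite divr_gt0// ltr_wpDl// sqr_ge0.
  have := H _ l0; rewrite az expr0n/= mulr0 add0r -mulrA divfK ?gt_eqF//.
  have := sqr_ge0 b; lra.
have agt0 : 0 < a by rewrite lt_neqAle eq_sym an0.
have a2 : 0 < a ^+ 2 by rewrite exprn_gt0.
(* This weight maximises 2 l Y - l^2 a^2. *)
have l0 : 0 < Y / a ^+ 2 by rewrite divr_gt0.
rewrite -ler_sqr ?nnegrE ?mulr_ge0 ?(ltW Y0)// exprMn.
have := H _ l0; rewrite -ler_pdivrMl//.
rewrite (_ : (Y / a ^+ 2) ^+ 2 * a ^+ 2 = a ^-2 * Y ^+ 2); last by field.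
rewrite (_ : 2 * _ * Y = 2 * (a ^-2 * Y ^+ 2)); last by field.
by lra.
Qed.

(** * Supports, and cut-offs as test functions *)

Lemma coord_le_enorm (R : realType) (v : 'I_3 -> R) i : `|v i| <= enorm v.
Proof.
rewrite -sqrtr_sqr; apply: ler_wsqrtr.
by rewrite (bigD1 i)//= lerDl sumr_ge0// => j _; exact: sqr_ge0.
Qed.

Lemma eball_subset_box (R : realType) (r : R) :
  eball 0 r `<=` `[- r, r] `*` `[- r, r] `*` `[- r, r].
Proof.
move=> x; rewrite /eball/= => xr.
have H i : `|xcoord (x - 0) i| <= r.
  exact: le_trans (coord_le_enorm _ i) (ltW xr).
have := H ord0; have := H (lift ord0 ord0).
have := H (lift ord0 (lift ord0 ord0)).
rewrite /xcoord !(tnth_nth 0) /= !subr0 !in_itv /= !ler_norml => -> -> -> //.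
Qed.

Lemma compact_supp (R : realType) (r : R) (psi : space3 R -> R) :
  supp psi `<=` eball 0 r -> compact (supp psi).
Proof.
move=> sr; apply: (subclosed_compact (@closed_closure _ _)).
  have cI := @segment_compact R (- r) r.
  exact: compact_setX (compact_setX cI cI) cI.
exact: subset_trans sr (@eball_subset_box _ _).
Qed.

(** Only the zero set of [psi0] enters, so the covering cut-offs, including the modified ones near
    the boundary, and their combinations with [psi0] all inherit its support. *)
Lemma supp_st_cutoff (R : realType) (eta : R -> R) (psi psi0 : space3 R -> R) :
  (forall x, psi0 x = 0 -> psi x = 0) ->
  supp (st_cutoff eta psi) `<=` supp psi0 `*` supp eta.
Proof.
move=> psi00 z zs; split.
  move=> U /= Uz; have [|w [/= wn0 wU]] := zs (fst @^-1` U).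
    exact: (cvg_fst Uz).
  exists w.1; split => //; apply: contraNneq wn0 => /psi00 e.
  by rewrite /st_cutoff e mulr0.
move=> U /= Uz; have [|w [/= wn0 wU]] := zs (snd @^-1` U).
  exact: (cvg_snd Uz).
exists w.2; split => //; apply: contraNneq wn0 => e.
by rewrite /st_cutoff e mul0r.
Qed.

Lemma test_fun_st_cutoff (R : realType) (Omega : set (space3 R)) (T r : R)
    (eta : R -> R) (psi psi0 : space3 R -> R) :
  smooth eta -> smooth psi -> supp eta `<=` `[0, T] ->
  supp psi0 `<=` eball 0 r -> eball 0 r `<=` Omega ->
  (forall x, psi0 x = 0 -> psi x = 0) ->
  test_fun Omega `[0, T] (st_cutoff eta psi).
Proof.
move=> Ceta Cpsi seta spsi0 rO psi00.
have sst := @supp_st_cutoff _ eta _ _ psi00; split.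
- exact: smooth_st_cutoff.
- apply: (subclosed_compact (@closed_closure _ _) _ sst).
  apply: compact_setX; first exact: compact_supp spsi0.
  apply: (subclosed_compact (@closed_closure _ _) _ seta).
  exact: segment_compact.
- by move=> z /sst[z1 z2]; split; [exact/rO/spsi0|exact: seta].
Qed.

(** * Linearity and domination for real integrals; measurability on cylinders *)

Lemma Rintegral_sum {d} {X : measurableType d} {R : realType}
    (mu : {measure set X -> \bar R}) (D : set X) n (g : 'I_n -> X -> R) :
  measurable D -> (forall i, mu.-integrable D (EFin \o g i)) ->
  \int[mu]_(z in D) (\sum_i g i z) = \sum_i \int[mu]_(z in D) g i z.
Proof.
move=> mD ig; rewrite /Rintegral.
under eq_integral do rewrite -sumEFin.
rewrite integral_sum// -sum_fine// => i _.
exact: (integrable_fin_num mD (ig i)).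
Qed.

Lemma integrable_sum_real {d} {X : measurableType d} {R : realType}
    (mu : {measure set X -> \bar R}) (D : set X) n (g : 'I_n -> X -> R) :
  measurable D -> (forall i, mu.-integrable D (EFin \o g i)) ->
  mu.-integrable D (EFin \o (fun z => \sum_i g i z)).
Proof.
move=> mD ig; rewrite (_ : _ \o _ = (fun z => \sum_i (g i z)%:E)%E).
  by apply: integrable_sum => // i _; exact: ig.
by apply/funext => z /=; rewrite sumEFin.
Qed.

Lemma Rintegral_lin {d} {X : measurableType d} {R : realType}
    (mu : {measure set X -> \bar R}) (D : set X) n (g : 'I_n -> X -> R)
    (h : X -> R) (a b : R) :
  measurable D -> (forall i, mu.-integrable D (EFin \o g i)) ->
  mu.-integrable D (EFin \o h) ->
  \int[mu]_(z in D) (a * (\sum_i g i z) + b * h z) =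
  a * (\sum_i \int[mu]_(z in D) g i z) + b * \int[mu]_(z in D) h z.
Proof.
move=> mD ig ih.
have isum := integrable_sum_real mD ig.
rewrite RintegralD ?RintegralZl ?Rintegral_sum//.
  exact: integrableZl isum.
exact: integrableZl ih.
Qed.

Lemma le_integrable_real {d} {X : measurableType d} {R : realType}
    (mu : {measure set X -> \bar R}) (D : set X) (g h : X -> R) :
  measurable D -> measurable_fun D g -> (forall z, D z -> `|g z| <= h z) ->
  mu.-integrable D (EFin \o h) -> mu.-integrable D (EFin \o g).
Proof.
move=> mD mg gh; apply: le_integrable => //; first exact/measurable_EFinP.
by move=> z Dz; rewrite /= lee_fin (le_trans (gh _ Dz)) ?ler_norm.
Qed.

Lemma closed_measurable_space3 (R : realType) (K : set (space3 R)) :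
  closed K -> measurable K.
Proof.
move=> cK; rewrite -(setCK K); apply: measurableC.
by apply: open_measurable_space3; exact: closed_openC.
Qed.

Lemma measurable_cylinder (R : realType) (A : set (space3 R)) (T : R) :
  measurable A -> measurable (cylinder A T).
Proof. by move=> mA; apply: measurableX => //; exact: measurable_itv. Qed.

Lemma measurable_sqnorm (R : realType) (D : set (spacetime3 R))
    (u : 'I_3 -> spacetime3 R -> R) :
  (forall i, measurable_fun D (u i)) -> measurable_fun D (sqnorm u).
Proof. by move=> mu; apply: measurable_sum => i; exact: measurable_funX. Qed.

Lemma sqnorm_ge0 (R : realType) (u : 'I_3 -> spacetime3 R -> R) z :
  0 <= sqnorm u z.
Proof. by apply: sumr_ge0 => i _; exact: sqr_ge0. Qed.

(** * Tonelli on space-time and integrability of the energy *)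

Section prod_sf.
Local Open Scope ereal_scope.
Context {d1 d2} {T1 : measurableType d1} {T2 : measurableType d2}.
Context {R : realType}.
Variable m1 : {sigma_finite_measure set T1 -> \bar R}.
Variable m2 : {sigma_finite_measure set T2 -> \bar R}.

Lemma sigma_finite_product_measure1 : sigma_finite setT (m1 \x m2).
Proof.
have [F TF mF] := sigma_finiteT m1; have [G TG mG] := sigma_finiteT m2.
(* Rectangles of the two exhaustions, enumerated by coding pairs; integers that code no pair give
   the empty set. *)
exists (fun k => if unpickle k is Some nm then F nm.1 `*` G nm.2 else set0).
  apply/seteqP; split => // -[x y] _.
  have [n _ Fx] : (\bigcup_i F i) x by rewrite -TF.
  have [m _ Gy] : (\bigcup_i G i) y by rewrite -TG.
  by exists (pickle (n, m)) => //; rewrite pickleK.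
move=> k; case: unpickle => [[n m]|]; last by rewrite measure0.
have [mFn Fn] := mF n; have [mGm Gm] := mG m; split; first exact: measurableX.
by rewrite product_measure1E// lte_mul_pinfty// ge0_fin_numE.
Qed.

Definition sigma_finite_prod_measure := m1 \x m2.
HB.instance Definition _ := Measure.on sigma_finite_prod_measure.
HB.instance Definition _ := Measure_isSigmaFinite.Build _ _ _
  sigma_finite_prod_measure sigma_finite_product_measure1.
End prod_sf.

(* The library's own sigma-finite instance on [\x] is shadowed by the one for
   subprobabilities, hence the detour through [sigma_finite_prod_measure]. *)
Definition leb3_sf (R : realType) :=
  (sigma_finite_prod_measure (sigma_finite_prod_measure
     (@lebesgue_measure R) (@lebesgue_measure R)) (@lebesgue_measure R)
   : {sigma_finite_measure set _ -> \bar R}).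

Lemma tonelli_spacetime3 (R : realType) (g : spacetime3 R -> \bar R) :
  measurable_fun setT g -> (forall z, (0 <= g z)%E) ->
  (\int[leb4 R]_z g z = \int[@lebesgue_measure R]_t \int[leb3 R]_x g (x, t))%E.
Proof.
move=> mg g0.
exact: (@fubini_tonelli2 _ _ _ _ R (leb3_sf R) (@lebesgue_measure R) g mg g0).
Qed.

Lemma measurable_slice_integral (R : realType) (g : spacetime3 R -> \bar R) :
  measurable_fun setT g -> (forall z, (0 <= g z)%E) ->
  measurable_fun setT (fun t => \int[leb3 R]_x g (x, t))%E.
Proof.
move=> mg g0.
exact: (@measurable_fun_fubini_tonelli_G _ _ _ _ R (leb3_sf R) g mg g0).
Qed.

(** By Tonelli, the space-time integral is the time integral of the slice energies, which are
    bounded for almost every time in a bounded interval. *)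
Lemma integrable_sqnorm_cylinder (R : realType) (K : set (space3 R)) (T M : R)
    (u : 'I_3 -> spacetime3 R -> R) :
  measurable K -> (forall i, measurable_fun (cylinder K T) (u i)) ->
  {ae @lebesgue_measure R, forall t, `[0, T]%classic t ->
      (\int[leb3 R]_(x in K) (sqnorm u (x, t))%:E <= M%:E)%E} ->
  (leb4 R).-integrable (cylinder K T) (EFin \o sqnorm u).
Proof.
move=> mK mu uM.
have mI : measurable (`[0, T]%classic : set (measurableTypeR R)).
  exact: measurable_itv.
have mKT := measurable_cylinder T mK.
have mg : measurable_fun (cylinder K T) (EFin \o sqnorm u).
  by apply/measurable_EFinP; exact: measurable_sqnorm.
apply/integrableP; split => //.
have -> : (\int[leb4 R]_(z in cylinder K T) `|(EFin \o sqnorm u) z|)%E =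
    (\int[leb4 R]_(z in cylinder K T) (EFin \o sqnorm u) z)%E.
  by apply: eq_integral => z _; rewrite /= ger0_norm// sqnorm_ge0.
rewrite integral_mkcond; set g := _ \_ _.
have mgT : measurable_fun setT g by apply/(measurable_restrictT _ mKT).
have g0 z : (0 <= g z)%E.
  by rewrite /g patchE; case: ifP => // _; rewrite lee_fin sqnorm_ge0.
rewrite tonelli_spacetime3//.
(* The majorant has to be non-negative, hence [|M|]; its integral is finite because [[0, T]] is
   bounded. *)
suff H : (\int[@lebesgue_measure R]_t \int[leb3 R]_x g (x, t) <=
    \int[@lebesgue_measure R]_t
      ((cst (`|M|)%:E : R -> \bar R) \_ `[0%R, T]%classic) t)%E.
  apply: le_lt_trans H _.
  rewrite -integral_mkcond integral_cst//= lebesgue_measure_itv/=.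
  by case: ifP => _; rewrite ?mule0// ltry.
apply: ae_ge0_le_integral => //.
- by move=> t _; apply: integral_ge0 => x _.
- exact: measurable_slice_integral.
- by move=> t _; rewrite patchE; case: ifP => // _; rewrite lee_fin.
- by apply: (measurable_restrictT (cst (`|M|%:E)) mI).1; exact: measurable_cst.
case: uM => N [mN N0 uMN]; exists N; split=> //; apply: subset_trans uMN.
apply: subsetC => t uMt _ /=; rewrite patchE.
case: ifPn => [/set_mem It|/negP It].
  apply: le_trans (le_trans (uMt It) _); last by rewrite lee_fin ler_norm.
  rewrite [leRHS]integral_mkcond le_eqVlt; apply/orP; left; apply/eqP.
  apply: eq_integral => x _; rewrite /g !patchE.
  have [/set_mem Kx|/negP Kx] := boolP (x \in K); first by rewrite mem_set.
  by rewrite memNset// => -[/= /mem_set].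
rewrite integral0_eq// => x _.
by rewrite /g patchE memNset// => -[_ /= /mem_set].
Qed.

(** * Pointwise bound on the heat operator *)

Lemma powR_anti_exponent (R : realType) (a r s : R) :
  0 <= a <= 1 -> 0 < r -> r <= s -> a `^ s <= a `^ r.
Proof.
move=> /andP[]; rewrite le_eqVlt => /predU1P[<- _|a0 a1] r0 rs.
  by rewrite !powR0 ?gt_eqF// (lt_le_trans r0).
by apply: ger_powR => //; rewrite a0.
Qed.

Section cutoff_estimates.
Context (R : realType) (nu T C0 delta : R) (eta : R -> R).
Hypotheses (nu_gt0 : 0 < nu) (T_gt0 : 0 < T) (C0_gt0 : 0 < C0)
  (delta_itv : 1 / 2 < delta < 1).
Hypothesis eta_cutoff : refined_time_cutoff C0 delta T eta.

Local Notation s := (2 * delta - 1).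

Let s_gt0 : 0 < s. Proof. by move/andP: delta_itv => -[? ?]; lra. Qed.

Let s_le_delta : s <= delta. Proof. by move/andP: delta_itv => -[? ?]; lra. Qed.

Let s_le1 : s <= 1.
Proof. by move/andP: delta_itv => -[? ?]; lra. Qed.

(** The time derivative costs C0/T and the Laplacian nu C0/r^2; T >= r^2/nu brings both to C0
    nu/r^2, whence the factor 2. As the cut-offs take values in [0,1] and 2 delta - 1 <= delta < 1,
    every power that occurs is dominated by the one with exponent 2 delta - 1. *)
Lemma heat_operator_bound (r : R) (psi : space3 R -> R) (z : spacetime3 R) :
  0 < r -> r ^+ 2 / nu <= T -> cutoff_bounds C0 delta r psi ->
  `|dt (st_cutoff eta psi) z + nu * lapx (st_cutoff eta psi) z| <=
  2 * C0 * nu / r ^+ 2 * st_cutoff eta psi z `^ s.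
Proof.
move=> r0 rT [Cpsi psi01 _ lap_psi].
have [Ceta eta01 _ deta] := eta_cutoff.
rewrite dt_st_cutoff// lapx_st_cutoff// /st_cutoff.
set t := z.2; set x := z.1.
have e01 := eta01 t; have p01 := psi01 x.
have /andP[e0 e1] := e01; have /andP[p0 p1] := p01.
have r2 : 0 < r ^+ 2 by rewrite exprn_gt0.
have es : eta t `^ delta <= eta t `^ s by exact: powR_anti_exponent.
have e1s : eta t <= eta t `^ s.
  by rewrite -{1}[eta t]powRr1//; apply: powR_anti_exponent => //; exact: s_le1.
have p1s : psi x <= psi x `^ s.
  by rewrite -{1}[psi x]powRr1//; apply: powR_anti_exponent => //; exact: s_le1.
have Tr : C0 / T <= C0 * nu / r ^+ 2.
  rewrite -mulrA ler_pM2l// -[nu in leRHS]invrK -invfM.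
  rewrite lef_pV2 ?posrE ?mulr_gt0 ?invr_gt0//.
  by rewrite mulrC.
rewrite powRM//; set E := eta t `^ s in es e1s *; set P := psi x `^ s in p1s *.
have E0 : 0 <= E by exact: powR_ge0.
have P0 : 0 <= P by exact: powR_ge0.
apply: le_trans (ler_normD _ _) _.
have -> : 2 * C0 * nu / r ^+ 2 * (E * P) =
    C0 * nu / r ^+ 2 * E * P + nu * (E * (C0 / r ^+ 2 * P)) by field; lra.
apply: lerD; rewrite !normrM.
  rewrite (ger0_norm p0); apply: ler_pM => //; apply: le_trans (deta t) _.
  by apply: ler_pM => //; [rewrite divr_ge0// ltW|exact: powR_ge0].
rewrite (gtr0_norm nu_gt0) ler_pM2l// (ger0_norm e0).
by apply: ler_pM => //; exact: lap_psi.
Qed.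

End cutoff_estimates.

(** * Linearity of the three densities in the spatial cut-off *)

Section linearity.
Context {R : realType}.

Lemma derive_lincomb {V : normedModType R} (g h : V -> R) (a b : R) (v x : V) :
  smooth g -> smooth h ->
  'D_v (fun y => a * g y + b * h y) x = a * 'D_v g x + b * 'D_v h x.
Proof.
move=> Cg Ch; have dg := @smooth_derivable _ _ _ x v Cg.
have dh := @smooth_derivable _ _ _ x v Ch.
rewrite -[LHS]/('D_v ((a \*: (g : V -> R^o)) + (b \*: (h : V -> R^o))) x).
rewrite (deriveD (derivableZ dg) (derivableZ dh)).
by rewrite (deriveZ _ dg) (deriveZ _ dh).
Qed.

Lemma smooth_lincomb {V : normedModType R} (g h : V -> R) (a b : R) :
  smooth g -> smooth h -> smooth (fun y => a * g y + b * h y).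
Proof.
by move=> Cg Ch; apply: smoothD; apply: smoothM => //; exact: smooth_cst.
Qed.

Lemma grad_lincomb (g h : space3 R -> R) (a b : R) x i :
  smooth g -> smooth h ->
  grad (fun y => a * g y + b * h y) x i = a * grad g x i + b * grad h x i.
Proof. exact: derive_lincomb. Qed.

Lemma lap_lincomb (g h : space3 R -> R) (a b : R) x :
  smooth g -> smooth h ->
  lap (fun y => a * g y + b * h y) x = a * lap g x + b * lap h x.
Proof.
move=> Cg Ch; rewrite /lap !mulr_sumr -big_split/=; apply: eq_bigr => i _.
rewrite (_ : (fun y => 'D_(evec R i) _ y) =
    (fun y => a * 'D_(evec R i) g y + b * 'D_(evec R i) h y)).
  by rewrite derive_lincomb//; exact: smooth_derive.
by apply/funext => y; rewrite derive_lincomb.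
Qed.

Context (eta : R -> R) (Ceta : smooth eta).

Lemma flux_density_lincomb u p (g h : space3 R -> R) (a b : R) z :
  smooth g -> smooth h ->
  flux_density u p (st_cutoff eta (fun y => a * g y + b * h y)) z =
  a * flux_density u p (st_cutoff eta g) z
  + b * flux_density u p (st_cutoff eta h) z.
Proof.
move=> Cg Ch; rewrite /flux_density (mulrCA a) (mulrCA b) -mulrDr.
congr (_ * _); rewrite !mulr_sumr -big_split/=; apply: eq_bigr => i _.
have Cgh := smooth_lincomb a b Cg Ch.
rewrite !dx_st_cutoff// grad_lincomb//.
by move: (grad g _ _) (grad h _ _) (u i z) (eta _) => *; ring.
Qed.

Definition heat_density (nu : R) (u : 'I_3 -> spacetime3 R -> R)
    (phi : spacetime3 R -> R) (z : spacetime3 R) : R :=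
  sqnorm u z / 2 * (dt phi z + nu * lapx phi z).

Lemma heat_density_lincomb nu u (g h : space3 R -> R) (a b : R) z :
  smooth g -> smooth h ->
  heat_density nu u (st_cutoff eta (fun y => a * g y + b * h y)) z =
  a * heat_density nu u (st_cutoff eta g) z
  + b * heat_density nu u (st_cutoff eta h) z.
Proof.
move=> Cg Ch; have Cgh := smooth_lincomb a b Cg Ch.
rewrite /heat_density !dt_st_cutoff// !lapx_st_cutoff// lap_lincomb//.
by move: (lap g _) (lap h _) (g _) (h _) (sqnorm u z) (eta _)
  (derive1 eta _) => *; ring.
Qed.

Definition force_density (f u : 'I_3 -> spacetime3 R -> R)
    (phi : spacetime3 R -> R) (z : spacetime3 R) : R :=
  (\sum_(i < 3) f i z * u i z) * phi z.

Lemma force_density_lincomb f u (g h : space3 R -> R) (a b : R) z :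
  force_density f u (st_cutoff eta (fun y => a * g y + b * h y)) z =
  a * force_density f u (st_cutoff eta g) z
  + b * force_density f u (st_cutoff eta h) z.
Proof.
rewrite /force_density /st_cutoff.
by move: (\sum_(i < 3) _) (g _) (h _) (eta _) => *; ring.
Qed.

(** Abstracting over the density lets the flux, heat and force terms share one induction. *)
Lemma density_sum_lincomb (dens : (spacetime3 R -> R) -> spacetime3 R -> R) :
  (forall (g h : space3 R -> R) a b z, smooth g -> smooth h ->
    dens (st_cutoff eta (fun y => a * g y + b * h y)) z =
    a * dens (st_cutoff eta g) z + b * dens (st_cutoff eta h) z) ->
  forall n (psi : 'I_n -> space3 R -> R) h a b z,
    (forall i, smooth (psi i)) -> smooth h ->
  dens (st_cutoff eta (fun y => a * (\sum_i psi i y) + b * h y)) z =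
  a * (\sum_i dens (st_cutoff eta (psi i)) z) + b * dens (st_cutoff eta h) z.
Proof.
move=> densL n psi h a b z Cpsi Ch; rewrite densL//; last exact: smooth_sum.
congr (a * _ + _); elim: n psi Cpsi => [|n IH] psi Cpsi.
  (* The zero cut-off is written as a trivial combination, so that two-term linearity also yields
     the empty sum. *)
  rewrite big_ord0 (_ : (fun y => _) = (fun y => 0 * h y + 0 * h y)).
    by rewrite densL// !mul0r addr0.
  by apply/funext => y; rewrite big_ord0 !mul0r addr0.
rewrite big_ord_recl -IH// (_ : (fun y => _) =
    (fun y => 1 * psi ord0 y + 1 * \sum_(i < n) psi (lift ord0 i) y)).
  by rewrite densL ?mul1r//; exact: smooth_sum.
by apply/funext => y; rewrite big_ord_recl !mul1r.
Qed.

End linearity.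

(** * Integrability of the densities and positivity of the energy balance *)

Section flux_estimates.
Context (R : realType) (Omega : set (space3 R)) (nu T R0 C0 delta : R).
Context (eta : R -> R) (psi0 : space3 R -> R).
Context (f u : 'I_3 -> spacetime3 R -> R) (p : spacetime3 R -> R).
Context (Du : 'I_3 -> 'I_3 -> spacetime3 R -> R).
Hypotheses (Omega_open : open Omega) (nu_gt0 : 0 < nu) (T_gt0 : 0 < T)
  (ball_Omega : eball 0 (2 * R0) `<=` Omega)
  (C0_gt0 : 0 < C0) (delta_itv : 1 / 2 < delta < 1)
  (eta_cutoff : refined_time_cutoff C0 delta T eta)
  (psi0_cutoff : refined_space_cutoff C0 delta 0 R0 psi0)
  (f_L2 : square_integrable_field (cylinder Omega T) f)
  (u_suitable : suitable_weak_solution nu Omega T f u p Du).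

Local Notation s := (2 * delta - 1).
Local Notation D := (cylinder Omega T).
Local Notation mu := (leb4 R).
(* The library puts two convertible measurable structures with different
   displays on [R]; [leb4 R] lives over this one. *)
Local Notation X := (measurableTypeR R * measurableTypeR R * measurableTypeR R
  * measurableTypeR R)%type.

Let s_gt0 : 0 < s. Proof. by move/andP: delta_itv => -[? ?]; lra. Qed.
Let s_le1 : s <= 1. Proof. by move/andP: delta_itv => -[? ?]; lra. Qed.

Let mD : measurable (D : set X).
Proof. by apply: measurable_cylinder; exact: open_measurable_space3. Qed.

Let Ceta : smooth eta. Proof. by case: eta_cutoff. Qed.
Let eta01 t : 0 <= eta t <= 1. Proof. by case: eta_cutoff. Qed.
Let Cpsi0 : smooth psi0. Proof. by case: psi0_cutoff => -[]. Qed.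
Let psi001 x : 0 <= psi0 x <= 1. Proof. by case: psi0_cutoff => -[]. Qed.

(** What [psi0], the interior cut-offs and the modified boundary ones have in common; this suffices
    to dominate the heat-free densities. *)
Definition subordinate (psi : space3 R -> R) : Prop :=
  [/\ smooth psi, forall x, 0 <= psi x <= 1 &
      forall x, psi0 x = 0 -> psi x = 0].

Let sub_psi0 : subordinate psi0. Proof. by []. Qed.

Let measurable_time (g : R -> R) (A : set (spacetime3 R)) : continuous g ->
  measurable_fun A (fun z : spacetime3 R => g z.2).
Proof.
move=> cg; apply: measurable_funTS.
apply: (measurableT_comp (continuous_measurable_fun cg)); exact: measurable_snd.
Qed.

Let measurable_space (g : space3 R -> R) (A : set (spacetime3 R)) :
  continuous g -> measurable_fun A (fun z : spacetime3 R => g z.1).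
Proof.
move=> cg; apply: measurable_funTS.
apply: (measurableT_comp (continuous_measurable_space3 cg)).
exact: measurable_fst.
Qed.

Let measurable_st_cutoff A psi : smooth psi ->
  measurable_fun A (st_cutoff eta psi).
Proof.
move=> Cpsi; apply: measurable_funM.
  exact: measurable_time (smooth_continuous Ceta).
exact: measurable_space (smooth_continuous Cpsi).
Qed.

Let measurable_u i : measurable_fun D (u i).
Proof. exact: (sws_meas_u u_suitable). Qed.

Let st_cutoff01 psi z : subordinate psi -> 0 <= st_cutoff eta psi z <= 1.
Proof.
move=> [_ psi01 _]; have /andP[e0 e1] := eta01 z.2.
have /andP[p0 p1] := psi01 z.1.
by rewrite /st_cutoff mulr_ge0//= mulr_ile1.
Qed.

Let K := supp psi0.

(** The common majorant: [u] is only locally square integrable in [Omega], so |u|^2 is restricted to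
    the compact support of [psi0]. *)
Let energy z : R := (sqnorm u \_ (cylinder K T)) z.

Let K_Omega : K `<=` Omega.
Proof. by case: psi0_cutoff => _ sK _; exact: subset_trans sK ball_Omega. Qed.

Let mK : measurable K.
Proof. by apply: closed_measurable_space3; exact: closed_closure. Qed.

Let KT_D : cylinder K T `<=` D. Proof. by move=> z [/K_Omega]. Qed.

Let mKT : measurable (cylinder K T : set X).
Proof. exact: measurable_cylinder. Qed.

Let integrable_energy : mu.-integrable D (EFin \o energy).
Proof.
have cK : compact K by case: psi0_cutoff => _ sK _; exact: compact_supp sK.
have [M uM] := sws_LinftyL2 u_suitable cK K_Omega.
have iu := @integrable_sqnorm_cylinder _ _ _ _ u mK
  (fun i => measurable_funS mD KT_D (@measurable_u i)) uM.
have := (@integrable_mkcond _ _ R (leb4 R) _ (EFin \o sqnorm u) mKT).1 iu.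
rewrite (_ : _ \_ _ = EFin \o energy).
  by apply: integrableS.
by apply/funext => z; rewrite /energy /= !patchE; case: ifP.
Qed.

Let cutoff_energy psi z : subordinate psi -> D z ->
  0 <= sqnorm u z * st_cutoff eta psi z `^ s <= energy z.
Proof.
move=> spsi [_ zT]; have /andP[c0 c1] := st_cutoff01 z spsi.
rewrite mulr_ge0 ?sqnorm_ge0 ?powR_ge0//= /energy patchE.
case: ifPn => [_|/negP zK].
  have s1 : (1 : R) `^ s = 1 by rewrite powR1.
  rewrite ler_piMr ?sqnorm_ge0// -[leRHS]s1.
  by apply: ge0_ler_powR; rewrite ?nnegrE// ltW.
(* Off the support the cut-off vanishes, and so does its power because the exponent is positive. *)
have p0 : psi0 z.1 = 0.
  apply/eqP; apply: contra_notT zK => p0; rewrite inE; split => //.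
  exact: subset_closure.
have [_ _ /(_ _ p0) pz] := spsi.
by rewrite /st_cutoff pz mulr0 powR0 ?gt_eqF// mulr0.
Qed.

Let st_cutoff_powR psi z : subordinate psi ->
  st_cutoff eta psi z <= st_cutoff eta psi z `^ s.
Proof.
move=> spsi; have /andP[c0 c1] := st_cutoff01 z spsi.
by rewrite -{1}[st_cutoff _ _ _]powRr1//; apply: powR_anti_exponent;
  rewrite ?c0.
Qed.

Let measurable_sqnorm_u : measurable_fun D (sqnorm u).
Proof. by apply: measurable_sqnorm => i; exact: measurable_u. Qed.

(** For [psi0] this is the integrand of e0; the exponent is the one in the heat operator bound, so
    that e0 controls the heat terms. *)
Definition kinetic psi z : R := sqnorm u z / 2 * st_cutoff eta psi z `^ s.

Let integrable_kinetic psi : subordinate psi ->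
  mu.-integrable D (EFin \o kinetic psi).
Proof.
move=> spsi; apply: (le_integrable_real mD) integrable_energy.
  apply: measurable_funM; first exact: measurable_funM.
  apply: measurableT_comp (measurable_powR _) _.
  by case: spsi => Cpsi _ _; exact: measurable_st_cutoff.
move=> z Dz; have /andP[k0 kE] := cutoff_energy spsi Dz.
by rewrite /kinetic ger0_norm; lra.
Qed.

Let integrable_u_cutoff psi : subordinate psi ->
  mu.-integrable D (EFin \o (fun z => sqnorm u z * st_cutoff eta psi z)).
Proof.
move=> spsi; apply: (le_integrable_real mD) integrable_energy.
  apply: measurable_funM => //.
  by case: spsi => Cpsi _ _; exact: measurable_st_cutoff.
move=> z Dz; have /andP[k0 kE] := cutoff_energy spsi Dz.
have /andP[c0 c1] := st_cutoff01 z spsi.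
rewrite ger0_norm; last exact: mulr_ge0 (sqnorm_ge0 _ _) c0.
apply: le_trans kE.
by rewrite ler_wpM2l ?sqnorm_ge0 ?st_cutoff_powR.
Qed.

Let integrable_sqnorm_f : mu.-integrable D (EFin \o sqnorm f).
Proof.
have [mf foo] := f_L2; apply/integrableP; split.
  by apply/measurable_EFinP; exact: measurable_sqnorm.
rewrite (_ : (\int[mu]_(z in D) _)%E = (\int[mu]_(z in D) (sqnorm f z)%:E)%E)//.
by apply: eq_integral => z _; rewrite /= ger0_norm// sqnorm_ge0.
Qed.

Let integrable_f_cutoff psi : subordinate psi ->
  mu.-integrable D (EFin \o (fun z => sqnorm f z * st_cutoff eta psi z)).
Proof.
move=> spsi; apply: (le_integrable_real mD) integrable_sqnorm_f.
  apply: measurable_funM.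
    by apply: measurable_sqnorm; case: f_L2.
  by case: spsi => Cpsi _ _; exact: measurable_st_cutoff.
move=> z Dz; have /andP[c0 c1] := st_cutoff01 z spsi.
rewrite ger0_norm; last exact: mulr_ge0 (sqnorm_ge0 _ _) c0.
by rewrite ler_piMr ?sqnorm_ge0.
Qed.

(* Cauchy-Schwarz in [R^3] with a free weight, to be optimised after
   integration. *)
Let dot_le (l : R) z :
  2 * l * `|\sum_(i < 3) f i z * u i z| <= l ^+ 2 * sqnorm f z + sqnorm u z.
Proof.
rewrite /sqnorm !big_ord_recl !big_ord0.
set a := f _ z; set b := f _ z; set c := f _ z.
set a' := u _ z; set b' := u _ z; set c' := u _ z.
have := sqr_ge0 (l * a - a'); have := sqr_ge0 (l * b - b').
have := sqr_ge0 (l * c - c'); have := sqr_ge0 (l * a + a').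
have := sqr_ge0 (l * b + b'); have := sqr_ge0 (l * c + c').
by case: (ler0P (a * a' + (b * b' + (c * c' + 0)))) => _; nra.
Qed.

Let force_le (l : R) psi z : subordinate psi ->
  2 * l * `|force_density f u (st_cutoff eta psi) z| <=
  l ^+ 2 * (sqnorm f z * st_cutoff eta psi z)
  + sqnorm u z * st_cutoff eta psi z.
Proof.
move=> spsi; have /andP[c0 c1] := st_cutoff01 z spsi.
rewrite /force_density normrM (ger0_norm c0).
move: (st_cutoff _ _ _) c0 => c c0.
by rewrite !mulrA -mulrDl ler_wpM2r// dot_le.
Qed.

Let measurable_force psi : smooth psi ->
  measurable_fun D (force_density f u (st_cutoff eta psi)).
Proof.
move=> Cpsi; apply: measurable_funM; last exact: measurable_st_cutoff.
apply: measurable_sum => i; apply: measurable_funM => //.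
by case: f_L2.
Qed.

Let integrable_force psi : subordinate psi ->
  mu.-integrable D (EFin \o force_density f u (st_cutoff eta psi)).
Proof.
move=> spsi.
have ih := integrableD mD (integrable_f_cutoff spsi) (integrable_u_cutoff spsi).
apply: (le_integrable_real mD) ih.
  by apply: measurable_force; case: spsi.
(* The weight 1 is enough for integrability; the optimal weight matters only in the final
   estimate. *)
move=> z Dz; have := force_le 1 z spsi; rewrite mulr1 expr1n mul1r.
have := normr_ge0 (force_density f u (st_cutoff eta psi) z); lra.
Qed.

Let test_cutoff psi : smooth psi -> (forall x, psi0 x = 0 -> psi x = 0) ->
  test_fun Omega `[0, T] (st_cutoff eta psi).
Proof.
move=> Cpsi psi00; have [_ _ seta _] := eta_cutoff.
have [_ spsi0 _] := psi0_cutoff.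
exact: test_fun_st_cutoff Ceta Cpsi seta spsi0 ball_Omega psi00.
Qed.

(** The functional L of the overview, seen as a function of the spatial cut-off. *)
Definition energy_balance psi : R :=
  flux_integral Omega T u p (st_cutoff eta psi)
  + heat_integral nu Omega T u (st_cutoff eta psi)
  + force_integral Omega T f u (st_cutoff eta psi).

(** No upper bound on [psi] is imposed, since the differences to which this is applied may exceed
    1. *)
Lemma energy_balance_ge0 psi : smooth psi -> (forall x, 0 <= psi x) ->
  (forall x, psi0 x = 0 -> psi x = 0) -> 0 <= energy_balance psi.
Proof.
move=> Cpsi psi_ge0 psi00.
have st0 z : 0 <= st_cutoff eta psi z.
  by rewrite mulr_ge0//; case/andP: (eta01 z.2).
have [_] := sws_energy u_suitable (test_cutoff Cpsi psi00) st0.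
have visc0 : 0 <= viscous_integral Omega T Du (st_cutoff eta psi).
  apply: Rintegral_ge0 => z _; rewrite mulr_ge0// /sqnorm2.
  by apply: sumr_ge0 => i _; apply: sumr_ge0 => j _; exact: sqr_ge0.
have := mulr_ge0 (ltW nu_gt0) visc0; rewrite /energy_balance; lra.
Qed.

(** Convergence of the cubic term is read off the local energy inequality, not obtained by
    domination. *)
Let integrable_flux psi : subordinate psi ->
  mu.-integrable D (EFin \o flux_density u p (st_cutoff eta psi)).
Proof.
move=> spsi; have [Cpsi _ psi00] := spsi.
have st0 z : 0 <= st_cutoff eta psi z by have /andP[] := st_cutoff01 z spsi.
by have [] := sws_energy u_suitable (test_cutoff Cpsi psi00) st0.
Qed.

(** * The heat term of one cut-off at scale [r] *)

Section scale.
Context (r : R) (psi : space3 R -> R).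
Hypotheses (r_gt0 : 0 < r) (rT : r ^+ 2 / nu <= T).
Hypotheses (spsi : subordinate psi) (psi_r : cutoff_bounds C0 delta r psi).

Let heat_le z :
  `|heat_density nu u (st_cutoff eta psi) z| <=
  2 * C0 * nu / r ^+ 2 * kinetic psi z.
Proof.
rewrite /heat_density /kinetic normrM ger0_norm ?divr_ge0 ?sqnorm_ge0//.
rewrite [leRHS]mulrCA ler_wpM2l ?divr_ge0 ?sqnorm_ge0//.
exact (heat_operator_bound nu_gt0 T_gt0 C0_gt0 delta_itv eta_cutoff z
  r_gt0 rT psi_r).
Qed.

Lemma integrable_heat :
  mu.-integrable D (EFin \o heat_density nu u (st_cutoff eta psi)).
Proof.
apply: (le_integrable_real mD _ (fun z _ => heat_le z)).
  apply: measurable_funM; first exact: measurable_funM.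
  have [Cpsi _ _] := spsi.
  rewrite (_ : (fun z => _) = (fun z : spacetime3 R =>
    'D_1 eta z.2 * psi z.1 + nu * (eta z.2 * lap psi z.1))); last first.
    apply/funext => z.
    by rewrite (dt_st_cutoff Ceta Cpsi) (lapx_st_cutoff _ Ceta Cpsi) derive1E.
  apply: measurable_funD.
    apply: measurable_funM.
      exact: measurable_time (smooth_continuous (smooth_derive _ Ceta)).
    exact: measurable_space (smooth_continuous Cpsi).
  apply: measurable_funM => //; apply: measurable_funM.
    exact: measurable_time (smooth_continuous Ceta).
  apply: measurable_space; apply: smooth_continuous.
  apply: smooth_sum => i; apply: smooth_derive; exact: smooth_derive.
exact: integrableZl (integrable_kinetic spsi).
Qed.

Lemma heat_integral_le :
  `|heat_integral nu Omega T u (st_cutoff eta psi)| <=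
  2 * C0 * nu / r ^+ 2 * \int[mu]_(z in D) kinetic psi z.
Proof.
apply: le_trans (le_normr_Rintegral mD integrable_heat) _.
have ik := integrable_kinetic spsi.
rewrite -(RintegralZl _ mD ik); apply: le_Rintegral => //.
- exact: integrable_norm integrable_heat.
- exact: integrableZl ik.
Qed.

End scale.

(** * Sums over the covering *)

Section covering.
Context (r K2 : R) (n : nat) (psi : 'I_n -> space3 R -> R).
Hypotheses (R0_gt0 : 0 < R0) (R0T : R0 ^+ 2 / nu <= T) (rR0 : 0 < r <= R0).
Hypothesis psi_bounds : forall i, cutoff_bounds C0 delta r (psi i).
Hypothesis psi_sum : forall x, psi0 x <= \sum_i psi i x <= K2 * psi0 x.
Hypothesis psi_overlap : forall x, #|[pred i | psi i x != 0]|%:R <= K2.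

Let r_gt0 : 0 < r. Proof. by case/andP: rR0. Qed.

Let rT : r ^+ 2 / nu <= T.
Proof.
apply: le_trans R0T; rewrite ler_pM2r ?invr_gt0//.
by case/andP: rR0 => _ rR; rewrite ler_sqr ?nnegrE// ltW.
Qed.

(** The terms of the sum are non-negative and their total is at most [K2 * psi0], so each vanishes
    where [psi0] does. *)
Let subordinate_psi i : subordinate (psi i).
Proof.
have [Cpsi psi01 _ _] := psi_bounds i; split=> // x px0.
have /andP[_] := psi_sum x; rewrite px0 mulr0 => psi_le0.
apply/eqP; rewrite eq_le; have /andP[-> _] := psi01 x; rewrite andbT.
apply: le_trans psi_le0; rewrite (bigD1 i)//= lerDl sumr_ge0// => j _.
by have [_ /(_ x)/andP[]] := psi_bounds j.
Qed.

Let Cpsi i : smooth (psi i). Proof. by case: (psi_bounds i). Qed.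

Let integral_lincomb (dens : (spacetime3 R -> R) -> spacetime3 R -> R) a b :
  (forall (g h : space3 R -> R) a b z, smooth g -> smooth h ->
    dens (st_cutoff eta (fun y => a * g y + b * h y)) z =
    a * dens (st_cutoff eta g) z + b * dens (st_cutoff eta h) z) ->
  (forall i, mu.-integrable D (EFin \o dens (st_cutoff eta (psi i)))) ->
  mu.-integrable D (EFin \o dens (st_cutoff eta psi0)) ->
  \int[mu]_(z in D)
    dens (st_cutoff eta (fun y => a * (\sum_i psi i y) + b * psi0 y)) z =
  a * (\sum_i \int[mu]_(z in D) dens (st_cutoff eta (psi i)) z)
  + b * \int[mu]_(z in D) dens (st_cutoff eta psi0) z.
Proof.
move=> densL ipsi ipsi0; rewrite -(Rintegral_lin _ _ mD ipsi ipsi0).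
by apply: eq_Rintegral => z _; rewrite (density_sum_lincomb densL).
Qed.

(** One identity serves both comparisons, with (a, b) equal to (1, -1) and to (-1, K2). *)
Let energy_balance_lincomb a b :
  energy_balance (fun y => a * (\sum_i psi i y) + b * psi0 y) =
  a * (\sum_i energy_balance (psi i)) + b * energy_balance psi0.
Proof.
have psi0_bounds : cutoff_bounds C0 delta R0 psi0 by case: psi0_cutoff.
rewrite /energy_balance; set chi := fun y => _; rewrite !big_split/=.
have -> : flux_integral Omega T u p (st_cutoff eta chi) =
    a * (\sum_i flux_integral Omega T u p (st_cutoff eta (psi i)))
    + b * flux_integral Omega T u p (st_cutoff eta psi0).
  exact: (integral_lincomb a b (flux_density_lincomb Ceta u p)
    (fun i => integrable_flux (subordinate_psi i)) (integrable_flux sub_psi0)).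
have -> : heat_integral nu Omega T u (st_cutoff eta chi) =
    a * (\sum_i heat_integral nu Omega T u (st_cutoff eta (psi i)))
    + b * heat_integral nu Omega T u (st_cutoff eta psi0).
  exact: (integral_lincomb a b (heat_density_lincomb Ceta nu u)
    (fun i => integrable_heat r_gt0 rT (subordinate_psi i) (psi_bounds i))
    (integrable_heat R0_gt0 R0T sub_psi0 psi0_bounds)).
have -> : force_integral Omega T f u (st_cutoff eta chi) =
    a * (\sum_i force_integral Omega T f u (st_cutoff eta (psi i)))
    + b * force_integral Omega T f u (st_cutoff eta psi0).
  exact: (integral_lincomb a b
    (fun g h a b z _ _ => force_density_lincomb eta f u g h a b z)
    (fun i => integrable_force (subordinate_psi i))
    (integrable_force sub_psi0)).
move: (\sum_i flux_integral _ _ _ _ _) (\sum_i heat_integral _ _ _ _ _)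
  (\sum_i force_integral _ _ _ _ _) (flux_integral _ _ _ _ _)
  (heat_integral _ _ _ _ _) (force_integral _ _ _ _ _) => *.
by ring.
Qed.

Lemma energy_balance_sum_bounds :
  energy_balance psi0 <= \sum_i energy_balance (psi i)
    <= K2 * energy_balance psi0.
Proof.
have chi_smooth a b : smooth (fun y => a * (\sum_i psi i y) + b * psi0 y).
  by apply: smooth_lincomb => //; exact: smooth_sum.
have chi0 a b x : psi0 x = 0 -> a * (\sum_i psi i x) + b * psi0 x = 0.
  move=> px0; rewrite px0 mulr0 addr0 big1 ?mulr0// => i _.
  by have [_ _ ->] := subordinate_psi i.
apply/andP; split.
  have := energy_balance_ge0 (chi_smooth 1 (-1)) _ (chi0 1 (-1)).
  rewrite energy_balance_lincomb mul1r mulN1r subr_ge0; apply => x.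
  by rewrite mul1r mulN1r subr_ge0; case/andP: (psi_sum x).
have := energy_balance_ge0 (chi_smooth (-1) K2) _ (chi0 (-1) K2).
rewrite energy_balance_lincomb mulN1r addrC subr_ge0; apply => x.
by rewrite mulN1r addrC subr_ge0; case/andP: (psi_sum x).
Qed.

(** The exponent lies below 1, so the bound on the sum of the [psi i] must be combined with the
    overlap bound; concavity then loses no more than [K2]. *)
Let kinetic_sum z : \sum_i kinetic (psi i) z <= K2 * kinetic psi0 z.
Proof.
rewrite /kinetic -mulr_sumr mulrCA ler_wpM2l ?divr_ge0 ?sqnorm_ge0//.
have /andP[e0 _] := eta01 z.2; have /andP[p0 _] := psi001 z.1.
have ppos i : 0 <= psi i z.1 by have [_ /(_ z.1)/andP[]] := psi_bounds i.
have [s1|s1] := ltP s 1; last first.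
  by move/andP: delta_itv => -[]; move: s1; lra.
rewrite /st_cutoff powRM// mulrCA.
under eq_bigr do rewrite powRM//.
rewrite -mulr_sumr ler_wpM2l ?powR_ge0//.
by apply: sum_powR_le; rewrite ?s_gt0//; case/andP: (psi_sum z.1).
Qed.

Lemma heat_integral_sum_le :
  `|\sum_i heat_integral nu Omega T u (st_cutoff eta (psi i))| <=
  2 * C0 * nu / r ^+ 2 * (K2 * \int[mu]_(z in D) kinetic psi0 z).
Proof.
apply: le_trans (ler_norm_sum _ _ _) _.
have ik i := integrable_kinetic (subordinate_psi i).
have ik0 := integrable_kinetic sub_psi0.
apply: le_trans (ler_sum _ (fun i _ =>
  heat_integral_le r_gt0 rT (subordinate_psi i) (psi_bounds i))) _.
have c0 : 0 <= 2 * C0 * nu / r ^+ 2.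
  by rewrite divr_ge0 ?exprn_ge0 ?mulr_ge0// ltW.
rewrite -mulr_sumr ler_wpM2l// -(Rintegral_sum mD ik) -(RintegralZl _ mD ik0).
apply: le_Rintegral => //.
- exact: integrable_sum_real.
- exact: integrableZl ik0.
Qed.

(** The cut-offs are summed under the integral before Cauchy-Schwarz, which is then applied once,
    with the weight of [psi0]. The 2 under the second root undoes the 1/2 in [kinetic]. *)
Lemma force_integral_sum_le :
  `|\sum_i force_integral Omega T f u (st_cutoff eta (psi i))| <=
  K2 * (Num.sqrt (\int[mu]_(z in D) (sqnorm f z * st_cutoff eta psi0 z))
       * Num.sqrt (2 * \int[mu]_(z in D) kinetic psi0 z)).
Proof.
have K2_ge0 : 0 <= K2.
  by apply: le_trans (psi_overlap 0).
have if0 := integrable_f_cutoff sub_psi0.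
have iu0 := integrable_u_cutoff sub_psi0.
have ik0 := integrable_kinetic sub_psi0.
have ifu i := integrable_force (subordinate_psi i).
have iabs i := integrable_norm (ifu i).
have ifu0 := integrable_force sub_psi0.
have iabs0 := integrable_norm ifu0.
pose Y := \int[mu]_(z in D) `|force_density f u (st_cutoff eta psi0) z|.
have sumY :
    `|\sum_i force_integral Omega T f u (st_cutoff eta (psi i))| <= K2 * Y.
  apply: le_trans (ler_norm_sum _ _ _) _.
  apply: le_trans (ler_sum _ (fun i _ => le_normr_Rintegral mD (ifu i))) _.
  rewrite -(Rintegral_sum mD iabs) -(RintegralZl _ mD iabs0).
  apply: le_Rintegral => //.
  - exact: integrable_sum_real.
  - exact: integrableZl iabs0.
  move=> z _; have /andP[e0 _] := eta01 z.2; have /andP[p0 _] := psi001 z.1.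
  have normE g : 0 <= g z.1 -> `|force_density f u (st_cutoff eta g) z| =
      `|\sum_(i < 3) f i z * u i z| * eta z.2 * g z.1.
    move=> g0.
    by rewrite /force_density normrM -mulrA (ger0_norm (mulr_ge0 _ _)).
  have psi_ge0 i : 0 <= psi i z.1 by have [_ /(_ z.1)/andP[]] := psi_bounds i.
  rewrite /= normE// (eq_bigr _ (fun i _ => normE (psi i) (psi_ge0 i))).
  rewrite -mulr_sumr mulrCA ler_wpM2l ?mulr_ge0//.
  by case/andP: (psi_sum z.1).
apply: le_trans sumY _; rewrite ler_wpM2l//.
(* For each weight [l] the inequality holds pointwise and is integrated; [l] is optimised
   afterwards. *)
apply: le_mul_of_quadratic; rewrite ?sqrtr_ge0// => l l0.
have kin0 : 0 <= \int[mu]_(z in D) kinetic psi0 z.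
  apply: Rintegral_ge0 => z _.
  by rewrite mulr_ge0 ?powR_ge0 ?divr_ge0 ?sqnorm_ge0.
rewrite !sqr_sqrtr ?mulr_ge0//; last first.
  apply: Rintegral_ge0 => z _; rewrite mulr_ge0 ?sqnorm_ge0//.
  by case/andP: (st_cutoff01 z sub_psi0).
rewrite /Y -(RintegralZl _ mD iabs0) -(RintegralZl _ mD if0).
rewrite -(RintegralZl _ mD ik0).
have i1 : mu.-integrable D (EFin \o (fun z =>
    l ^+ 2 * (sqnorm f z * st_cutoff eta psi0 z))).
  exact: (integrableZl mD (l ^+ 2) if0).
have i2 : mu.-integrable D (EFin \o (fun z => 2 * kinetic psi0 z)).
  exact: (integrableZl mD 2 ik0).
rewrite -(RintegralD mD i1 i2); apply: le_Rintegral => //.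
- exact: integrableZl iabs0.
- exact: (integrableD mD i1 i2).
move=> z _; apply: le_trans (force_le l z sub_psi0) _.
rewrite lerD2l /kinetic.
have -> (a b : R) : 2 * (a / 2 * b) = a * b by field.
by rewrite ler_wpM2l ?sqnorm_ge0// st_cutoff_powR.
Qed.

End covering.
End flux_estimates.

(** * Assembling the constants *)

Lemma enorm_xcoord0 (R : realType) : enorm (xcoord (0 : space3 R)) = 0.
Proof.
apply/eqP; rewrite sqrtr_eq0 big1// => i _.
by case: i => -[|[|[|//]]] ?; rewrite /xcoord (tnth_nth 0)/= expr0n.
Qed.

(** The origin lies in some ball of the covering, hence in its double. The bound allows errors of
    size eps0 to be absorbed into multiples of K2 eps0. *)
Lemma refined_covering_multiplicity_ge1 (R : realType) (C0 delta K1 K2 R0 : R)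
    (psi0 : space3 R -> R) (r : R) n (c : 'I_n -> space3 R)
    (psi : 'I_n -> space3 R -> R) :
  0 < R0 -> refined_covering C0 delta K1 K2 R0 psi0 r c psi -> 1 <= K2.
Proof.
move=> R0_gt0 cov; have /andP[r0 _] := rc_scale cov.
have B0 : eball 0 R0 (0 : space3 R) by rewrite /eball/= subrr enorm_xcoord0.
apply: le_trans (rc_multiplicity cov B0).
have [i _ ci] := rc_cover cov B0.
rewrite ler1n; apply/card_gt0P; exists i; rewrite inE.
by apply: lt_trans ci _; lra.
Qed.

(** Below, 1 - 1/4 - 1/2 = 1/4 is left over; above, K2 + 3/4 <= 9 K2 / 4 since K2 >= 1. Division by
    q in [1, K1] costs K1 below and nothing above. *)
Lemma flux_average_bounds (R : realType) (N eps K1 K2 q L H G : R) :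
  0 < N -> 0 < eps -> 0 < K1 -> 1 <= K2 -> 1 <= q <= K1 ->
  N * eps <= L <= K2 * (N * eps) -> `|H| <= N * eps / 4 ->
  `|G| <= N * eps / 2 ->
  1 / (4 * K1) * eps <= (L - H - G) / (N * q) <= 9 * K2 / 4 * eps.
Proof.
move=> N0 e0 K10 K21 /andP[q1 qK] /andP[L1 L2] Hb Gb.
have q0 : 0 < q by lra.
have Ne : 0 < N * eps by exact: mulr_gt0.
have := Hb; have := Gb; rewrite !ler_norml => /andP[G1 G2] /andP[H1 H2].
rewrite ler_pdivlMr ?mulr_gt0// ler_pdivrMr ?mulr_gt0//; apply/andP; split.
  apply: (@le_trans _ _ (N * eps / 4)); last lra.
  have -> : 1 / (4 * K1) * eps * (N * q) = N * eps / 4 * (q / K1).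
    by field; rewrite gt_eqF.
  by apply: ler_piMr; [lra|rewrite ler_pdivrMr// mul1r].
have Ke : N * eps <= K2 * (N * eps) by rewrite ler_peMl// ltW.
apply: (@le_trans _ _ (9 / 4 * (K2 * (N * eps)))); first lra.
have -> : 9 * K2 / 4 * eps * (N * q) = 9 / 4 * (K2 * (N * eps)) * q by ring.
by apply: ler_peMr => //; lra.
Qed.

Theorem theorem1 (R : realType)
  (* domain and constants *)
  (Omega : set (space3 R)) (nu T R0 C0 delta K1 K2 : R)
  (Omega_neq0 : Omega !=set0) (Omega_open : open Omega)
  (Omega_connected : connected Omega)
  (nu_gt0 : 0 < nu) (T_gt0 : 0 < T) (R0_gt0 : 0 < R0)
  (ball_Omega : eball 0 (2 * R0) `<=` Omega)
  (C0_gt0 : 0 < C0) (delta_itv : 1 / 2 < delta < 1)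
  (K1_gt0 : 0 < K1) (K2_gt0 : 0 < K2)
  (* global cut-off *)
  (eta : R -> R) (psi0 : space3 R -> R)
  (eta_cutoff : refined_time_cutoff C0 delta T eta)
  (psi0_cutoff : refined_space_cutoff C0 delta 0 R0 psi0)
  (* the solution; Du is the weak gradient of u *)
  (f u : 'I_3 -> spacetime3 R -> R) (p : spacetime3 R -> R)
  (Du : 'I_3 -> 'I_3 -> spacetime3 R -> R)
  (f_L2 : square_integrable_field (cylinder Omega T) f)
  (u_suitable : suitable_weak_solution nu Omega T f u p Du) :
  let phi0 := st_cutoff eta psi0 in
  let e0 := global_energy delta Omega T R0 u phi0 in
  let F0 := global_force Omega T R0 f phi0 in
  let eps0 := global_dissipation nu Omega T R0 f u p Du phi0 in
  let alpha0 := Num.sqrt 8 * K2 in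
  let beta0 := 8 * C0 * K2 in
  let tau0 := Num.sqrt (nu * e0 / eps0) in
  R0 ^+ 2 / nu <= T ->
  0 < eps0 ->
  alpha0 * F0 * Num.sqrt e0 <= eps0 ->
  beta0 * (nu * (e0 / R0 ^+ 2)) <= eps0 ->
  forall (r : R) (n : nat) (c : 'I_n -> space3 R) (psi : 'I_n -> space3 R -> R),
  Num.sqrt beta0 * tau0 <= r <= R0 ->
  refined_covering C0 delta K1 K2 R0 psi0 r c psi ->
  1 / (4 * K1) * eps0 <= averaged_flux Omega T r u p eta psi
    <= 9 * K2 / 4 * eps0.
Proof.
move=> phi0 e0 F0 eps0 alpha0 beta0 tau0 R0T eps_gt0 force_small _ r n c psi
  /andP[tau_r rR0] cov.
have K21 := refined_covering_multiplicity_ge1 R0_gt0 cov.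
have /andP[r_gt0 _] := rc_scale cov.
have /andP[n_lo n_hi] := rc_card cov.
have rR : 0 < r <= R0 by rewrite r_gt0.
set N := T * R0 ^+ 3.
have R03 : 0 < R0 ^+ 3 by rewrite exprn_gt0.
have N_gt0 : 0 < N by rewrite mulr_gt0.
have NV : 1 / T * (1 / R0 ^+ 3) = N^-1 by rewrite !div1r -invfM.
pose E := \int[leb4 R]_(z in cylinder Omega T) kinetic delta eta u psi0 z.
pose A := \int[leb4 R]_(z in cylinder Omega T) (sqnorm f z * phi0 z).
have E_ge0 : 0 <= E.
  apply: Rintegral_ge0 => z _.
  by rewrite mulr_ge0 ?powR_ge0 ?divr_ge0 ?sqnorm_ge0.
have e0E : e0 = N^-1 * E by rewrite -NV.
have F0A : F0 = Num.sqrt (N^-1 * A) by rewrite -NV.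
have EN : E = N * e0 by rewrite e0E mulVKf ?gt_eqF.
have e0_ge0 : 0 <= e0 by rewrite e0E mulr_ge0// invr_ge0 ltW.
have bal0 : energy_balance Omega nu T eta f u p psi0 = N * eps0.
  rewrite /eps0 /global_dissipation NV mulVKf ?gt_eqF//.
  rewrite /anomalous_dissipation /energy_balance -/phi0.
  by rewrite addrC -!addrA; ring.
have bal := energy_balance_sum_bounds Omega_open nu_gt0 T_gt0 ball_Omega C0_gt0
  delta_itv eta_cutoff psi0_cutoff f_L2 u_suitable R0_gt0 R0T rR
  (rc_bounds cov) (rc_sum cov).
have heat := heat_integral_sum_le Omega_open nu_gt0 T_gt0 ball_Omega C0_gt0
  delta_itv eta_cutoff psi0_cutoff u_suitable R0_gt0 R0T rR
  (rc_bounds cov) (rc_sum cov) (rc_overlap cov).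
have force := force_integral_sum_le Omega_open ball_Omega
  delta_itv eta_cutoff psi0_cutoff f_L2 u_suitable
  (rc_bounds cov) (rc_sum cov) (rc_overlap cov).
rewrite bal0 in bal.
clearbody eps0 e0 F0.
have K2_ge0 : 0 <= K2 := le_trans ler01 K21.
have beta0_ge0 : 0 <= beta0 by rewrite /beta0 !mulr_ge0// ltW.
have heat_small :
    `|\sum_i heat_integral nu Omega T u (st_cutoff eta (psi i))|
    <= N * eps0 / 4.
  apply: le_trans heat _; rewrite -/E EN.
  (* The lower bound sqrt beta0 tau0 <= r, squared and cleared of denominators. *)
  have scale : beta0 * (nu * e0) <= eps0 * r ^+ 2.
    have x0 : 0 <= nu * e0 / eps0.
      by rewrite divr_ge0 ?mulr_ge0 ?(ltW nu_gt0) ?(ltW eps_gt0).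
    have : (Num.sqrt beta0 * tau0) ^+ 2 <= r ^+ 2.
      by rewrite ler_sqr ?nnegrE ?mulr_ge0 ?sqrtr_ge0// ltW.
    rewrite exprMn /tau0 !sqr_sqrtr// [X in X <= _ -> _]mulrA.
    by rewrite ler_pdivrMr// (mulrC eps0).
  (* Since 2 C0 K2 = beta0/4, the constant 8 in [beta0] is what yields a quarter. *)
  have -> : 2 * C0 * nu / r ^+ 2 * (K2 * (N * e0)) =
      N / 4 * (beta0 * (nu * e0)) / r ^+ 2.
    by rewrite /beta0; field; rewrite gt_eqF.
  rewrite ler_pdivrMr ?exprn_gt0//.
  have -> : N * eps0 / 4 * r ^+ 2 = N / 4 * (eps0 * r ^+ 2) by field.
  by rewrite ler_wpM2l// divr_ge0// ltW.
have force_half :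
    `|\sum_i force_integral Omega T f u (st_cutoff eta (psi i))|
    <= N * eps0 / 2.
  apply: le_trans force _; rewrite -/E -/phi0 -/A.
  have -> : Num.sqrt A = Num.sqrt N * F0.
    by rewrite F0A -(sqrtrM _ (ltW N_gt0)) mulVKf ?gt_eqF.
  have -> : Num.sqrt (2 * E) = Num.sqrt N * (Num.sqrt 2 * Num.sqrt e0).
    by rewrite EN (mulrCA 2) (sqrtrM _ (ltW N_gt0)) (@sqrtrM _ 2).
  (* Hence sqrt 2 K2 = alpha0/2, which yields the half. *)
  have sqrt8 : Num.sqrt 8 = 2 * Num.sqrt 2 :> R.
    rewrite (_ : 8 = 2 ^+ 2 * 2); last by ring.
    by rewrite sqrtrM ?sqr_ge0// sqrtr_sqr ger0_norm.
  have -> : K2 * (Num.sqrt N * F0 * (Num.sqrt N * (Num.sqrt 2 * Num.sqrt e0)))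
      = Num.sqrt N ^+ 2 * (alpha0 * F0 * Num.sqrt e0) / 2.
    by rewrite /alpha0 sqrt8; field.
  rewrite (sqr_sqrtr (ltW N_gt0)) ler_pM2r ?invr_gt0//.
  by rewrite ler_pM2l.
(* The flux normalisation n T r^3 equals [N * q]; the cardinality bounds of the covering say exactly
   that q lies in [1, K1]. *)
pose q := n%:R * (r / R0) ^+ 3.
have q_bounds : 1 <= q <= K1.
  have Rr : 0 < (R0 / r) ^+ 3 by rewrite exprn_gt0// divr_gt0.
  have -> : q = n%:R / (R0 / r) ^+ 3 by rewrite /q -exprVn invf_div.
  by rewrite ler_pdivlMr// mul1r n_lo ler_pdivrMr.
have avgE : averaged_flux Omega T r u p eta psi =
    (\sum_i energy_balance Omega nu T eta f u p (psi i)
     - \sum_i heat_integral nu Omega T u (st_cutoff eta (psi i))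
     - \sum_i force_integral Omega T f u (st_cutoff eta (psi i))) / (N * q).
  rewrite -!sumrB /averaged_flux /local_flux -mulr_sumr.
  have n_gt0 : 0 < n%:R :> R.
    by apply: lt_le_trans n_lo; rewrite exprn_gt0// divr_gt0.
  rewrite [in RHS](eq_bigr (fun i =>
    flux_integral Omega T u p (st_cutoff eta (psi i)))).
    by rewrite /N /q; field; rewrite !gt_eqF.
  by move=> i _; rewrite /energy_balance addrAC addrK addrK.
rewrite avgE.
exact: flux_average_bounds.
Qed.
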